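(* Let $(d_N)_N$ be a sequence of integers with $1\le d_N\le N-1$ and $Nd_N$ even, for which there exists a constant $\eta>0$ such that $d_N\to\infty$, $N-d_N\to\infty$ and $\left|\frac N2-d_N-\eta\sqrt{d_N}\right|\to\infty$ as $N\to\infty$. Let $G_{N,d_N}$ be a uniform $d_N$-regular graph on $[N]$. Then for every fixed finite simple graph $T$ with $n$ edges, as $N\to\infty$, $$\mathbb P(T\subset G_{N,d_N})=\left(\frac{d_N}{N}\right)^n\left(1+o\big(d_N^{-1/2}\big)\right).$$
   Context: $[N]=\{1,\ldots,N\}$. The graph $G_{N,d_N}$ is chosen uniformly at random among all simple undirected $d_N$-regular graphs on $[N]$. The vertices of $T$ are named by fixed positive integers, $N$ is taken larger than all of them, and $T\subset G_{N,d_N}$ means that every edge of $T$ is an edge of $G_{N,d_N}$. *)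

(* Defs.v *)
From HB Require Import structures.
From mathcomp Require Import all_boot all_order all_algebra.
From mathcomp Require Import all_classical all_reals all_analysis.
Set Implicit Arguments.
Unset Strict Implicit.
Unset Printing Implicit Defensive.
Import Order.TTheory GRing.Theory Num.Theory.
Import numFieldNormedType.Exports.
Local Open Scope ring_scope.

(* A graph on the finite vertex type V is identified with its set of edges. *)
Definition simple_graph (V : finType) (E : {set {set V}}) : bool :=
  [forall e in E, #|e| == 2%N].

Definition degree (V : finType) (E : {set {set V}}) (v : V) : nat :=
  #|[set e in E | v \in e]|.

Definition regular (V : finType) (d : nat) (E : {set {set V}}) : bool :=
  [forall v, degree E v == d].

Definition regular_graphs (N d : nat) : {set {set {set 'I_N}}} :=
  [set G | simple_graph G & regular d G].

(* The index i : 'I_N stands for the vertex i.+1 of [N] = {1, ..., N}, and the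
   vertex v of T for the integer name v.  If some endpoint of an edge of T is
   not named by an element of [N], then T is not contained in G. *)
Definition subgraph (V : finType) (name : V -> nat) (T : {set {set V}})
    (N : nat) (G : {set {set 'I_N}}) : bool :=
  [forall u, forall v, ([set u; v] \in T) ==>
    [exists i : 'I_N, exists j : 'I_N,
      [&& i.+1 == name u, j.+1 == name v & [set i; j] \in G]]].

Definition prob_subgraph (R : realType) (V : finType) (name : V -> nat)
    (T : {set {set V}}) (N d : nat) : R :=
  #|[set G in regular_graphs N d | subgraph name T G]|%:R
    / #|regular_graphs N d|%:R.

(* Main.v *)
Require Import Defs.
From HB Require Import structures.
From mathcomp Require Import all_boot all_order all_algebra.
From mathcomp Require Import fingroup perm zify ring lra.
Set Implicit Arguments.
Unset Strict Implicit.
Unset Printing Implicit Defensive.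
Import Order.TTheory GRing.Theory Num.Theory.
Local Open Scope ring_scope.

(** Write c(T) for the number of d-regular graphs on [N] that contain the edge
    set T, and p = d / N.  The relative error turns out to be O(1/d), with a
    constant depending on the number of edges only, as soon as d and N - d are
    large; this is much smaller than d^(-1/2).

    The heart is that adding one edge uv to T multiplies c(T) by p (1 + O(1/d))
    when 2 d <= N ([edge_estimate]).  If one of its ends, say w, is a vertex
    outside T, this is regularity plus symmetry: the sum of c(T + ux) over all x
    is d c(T), and all fresh x contribute equally ([pendant_upper],
    [pendant_lower]).  It remains to compare c(T + uv), where v may be a vertex
    of T, with c(T + uw), where w is fresh.  In a graph containing T + uw but not
    uv, choose a neighbour z of v that is not a neighbour of w, and switch along
    the 4-cycle u w z v: remove uw and vz, insert uv and wz.  This preserves all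
    degrees, and it preserves T unless vz is an edge of T.  Both sides of the
    switching have the same number m of vertices adjacent to v but not to w, so
    double counting shows that the two classes have equal size up to a relative
    error at most #|T| / m ([switch_sum], [card_containing_diff]).  Consequently
    c(T + uv) <= c(T + uw), without error ([switch_le]), and the reverse
    inequality holds up to O(1/d) if m < d/8 is improbable ([switch_ge]).

    The event m < d/8 means that v and w have more than about 7d/8 common
    neighbours, whereas about p d <= d/2 are expected.  The exact inequality
    [switch_le] is itself enough to control this: iterated, it bounds c(T + S)
    by roughly p^#|S| c(T) for every edge set S ([superset_upper]), hence the
    r-th binomial moment of the codegree.  With r proportional to d the
    resulting tail is exponentially small ([common_tail], [private_tail]).

    Adding the edges of T one at a time settles 2 d <= N ([sparse_estimate]).
    For larger d the complement is a uniform regular graph of degree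
    d' = N - 1 - d, and inclusion-exclusion over the subsets S of T expresses
    c(T) by the counts for the complement; if S is not empty, these are known
    up to O((d'/N)^#|S| / d') = O(1/N) times the number of all regular graphs
    ([inclusion_exclusion], [uniform_estimate]).  Finally, a circulant graph
    shows that the probabilities are not quotients by zero
    ([regular_graph_exists]). *)

(** * Edges and degrees *)

Lemma edge_inj (V : finType) (v : V) : injective (fun x => [set v; x]).
Proof.
move=> x y e; have : y \in [set v; x] by rewrite e !inE eqxx orbT.
have : x \in [set v; y] by rewrite -e !inE eqxx orbT.
by rewrite !inE => /orP[/eqP->|/eqP//] /orP[/eqP|/eqP].
Qed.

Lemma loop_notin (V : finType) (G : {set {set V}}) (v x : V) :
  simple_graph G -> [set v; x] \in G -> v != x.
Proof.
move=> sG eG; have := implyP (forallP sG [set v; x]) eG.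
by rewrite cards2; case: (v != x).
Qed.

Lemma edgeP (V : finType) (G : {set {set V}}) (e : {set V}) (v : V) :
  simple_graph G -> e \in G -> v \in e -> exists2 x, v != x & e = [set v; x].
Proof.
move=> /forallP/(_ e)/implyP h /h /cards2P [x] [y] [xy ->].
rewrite !inE => /orP[/eqP->|/eqP->]; first by exists y.
by exists x; rewrite 1?eq_sym // setUC.
Qed.

Lemma degreeE (V : finType) (G : {set {set V}}) (v : V) :
  simple_graph G -> degree G v = #|[set x | [set v; x] \in G]|.
Proof.
move=> sG; rewrite /degree -(card_imset _ (@edge_inj V v)).
apply: eq_card => e; rewrite !inE; apply/andP/imsetP.
  by case=> eG /(edgeP sG eG)[x _ ee]; exists x; rewrite ?inE -?ee.
by case=> x; rewrite inE => ? ->; rewrite !inE eqxx.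
Qed.

Lemma degree_sum (V : finType) (G : {set {set V}}) (v : V) :
  degree G v = (\sum_(e in G) (v \in e))%N.
Proof.
rewrite /degree -sum1_card big_mkcond /= [RHS]big_mkcond /=.
by apply: eq_bigr => e _; rewrite !inE; case: (e \in G); case: (v \in e).
Qed.

Definition containing (N d : nat) (T : {set {set 'I_N}}) :=
  [set G in regular_graphs N d | T \subset G].

Lemma containingU1 N d (T : {set {set 'I_N}}) (e : {set 'I_N}) :
  containing d (e |: T) = [set G in containing d T | e \in G].
Proof.
apply/setP => G; rewrite !inE subUset sub1set -!andbA; do 2!congr andb.
by rewrite andbC.
Qed.

Lemma containing_sub N d (T U : {set {set 'I_N}}) :
  T \subset U -> containing d U \subset containing d T.
Proof.
move=> TU; apply/subsetP => G; rewrite !inE => /andP[-> /=].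
exact: subset_trans.
Qed.

(** * Relabelling vertices and pendant edges *)

Definition relabel (V : finType) (s : {perm V}) (G : {set {set V}}) :=
  [set [set s x | x in (e : {set V})] | e in G].

Lemma relabel_inj (V : finType) (s : {perm V}) : injective (relabel s).
Proof. by do 2!apply: imset_inj; apply: perm_inj. Qed.

Lemma relabel_regular N d (s : {perm 'I_N}) (G : {set {set 'I_N}}) :
  G \in regular_graphs N d -> relabel s G \in regular_graphs N d.
Proof.
rewrite !inE => /andP[/forallP sG /forallP rG]; apply/andP; split.
  apply/forallP => f; apply/implyP => /imsetP[e eG ->].
  by rewrite card_imset; [exact: (implyP (sG e)) | exact: perm_inj].
apply/forallP => v; rewrite -(eqP (rG (s^-1%g v))) !degree_sum.
rewrite big_imset /=; last by move=> x y _ _; apply: imset_inj; apply: perm_inj.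
apply/eqP/eq_bigr => e _; rewrite -{1}[v](permKV s) mem_imset //; exact: perm_inj.
Qed.

Lemma card_containing_relabel N d (s : {perm 'I_N}) (T : {set {set 'I_N}}) :
  (#|containing d T| <= #|containing d (relabel s T)|)%N.
Proof.
rewrite -(card_imset _ (@relabel_inj _ s)); apply: subset_leq_card.
apply/subsetP => _ /imsetP[G GT ->].
have /setIdP[rG TG] := GT.
by apply/setIdP; split; [exact: relabel_regular | exact: imsetS].
Qed.

Lemma relabel_id (V : finType) (s : {perm V}) (T : {set {set V}}) :
  {in cover T, s =1 id} -> relabel s T = T.
Proof.
move=> sT; rewrite /relabel -[RHS]imset_id; apply: eq_in_imset => e eT.
rewrite -[RHS]imset_id; apply: eq_in_imset => x xe; apply: sT.
by apply/bigcupP; exists e.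
Qed.

(** Transposing x and w fixes T and u. *)
Lemma card_containing_fresh N d (T : {set {set 'I_N}}) (u x w : 'I_N) :
  x \notin u |: cover T -> w \notin u |: cover T ->
  #|containing d ([set u; x] |: T)| = #|containing d ([set u; w] |: T)|.
Proof.
suff le y z : y \notin u |: cover T -> z \notin u |: cover T ->
  (#|containing d ([set u; y] |: T)| <= #|containing d ([set u; z] |: T)|)%N.
  by move=> xF wF; apply/eqP; rewrite eqn_leq !le.
rewrite !inE !negb_or => /andP[yu yT] /andP[zu zT].
suff -> : [set u; z] |: T = relabel (tperm y z) ([set u; y] |: T).
  exact: card_containing_relabel.
rewrite /relabel imsetU1 -/(relabel _ _) relabel_id.
  by rewrite imsetU1 imset_set1 tpermL tpermD.
by move=> t tT; rewrite tpermD //; apply: contraTneq tT => <-.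
Qed.

(** Both sides count the pairs of a graph containing T and a neighbour of u in
    it. *)
Lemma degree_count N d (T : {set {set 'I_N}}) (u : 'I_N) :
  (d * #|containing d T| = \sum_x #|containing d ([set u; x] |: T)|)%N.
Proof.
rewrite mulnC -sum_nat_const.
transitivity (\sum_(G in containing d T) \sum_(x | [set u; x] \in G) 1)%N.
  apply: eq_bigr => G; rewrite !inE => /andP[/andP[sG /forallP/(_ u)/eqP <-] _].
  by rewrite degreeE // -sum1_card; apply: eq_bigl => x; rewrite inE.
rewrite (exchange_big_dep xpredT) //=; apply: eq_bigr => x _.
rewrite sum1_card; apply: eq_card => G.
by rewrite containingU1 unfold_in /= [RHS]inE.
Qed.

(** In [degree_count], the vertices x outside T and u all contribute the same. *)
Lemma pendant_upper N d (T : {set {set 'I_N}}) (u w : 'I_N) :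
  w \notin u |: cover T ->
  ((N - #|u |: cover T|) * #|containing d ([set u; w] |: T)|
    <= d * #|containing d T|)%N.
Proof.
move=> wF; have <- : #|~: (u |: cover T)| = (N - #|u |: cover T|)%N.
  by rewrite cardsCs setCK card_ord.
rewrite (degree_count _ _ u) -sum_nat_const.
rewrite [leqRHS](bigID (mem (~: (u |: cover T)))) /=.
apply: leq_trans (leq_addr _ _); apply: leq_sum => x; rewrite in_setC => xF.
by rewrite (card_containing_fresh _ xF wF).
Qed.

(** In [degree_count], the few vertices of T contribute at most c(T) each. *)
Lemma pendant_lower N d (T : {set {set 'I_N}}) (u w : 'I_N) :
  w \notin u |: cover T ->
  (d * #|containing d T| <= N * #|containing d ([set u; w] |: T)|
     + #|u |: cover T| * #|containing d T|)%N.
Proof.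
move=> wF; rewrite (degree_count _ _ u) (bigID (mem (u |: cover T))) /= addnC.
apply: leq_add.
  rewrite -[X in (_ <= X * _)%N](card_ord N) -sum_nat_const big_mkcond /=.
  apply: leq_sum => x _; case: ifP => // xF.
  by rewrite (card_containing_fresh _ xF wF).
rewrite -sum_nat_const; apply: leq_sum => x _; apply: subset_leq_card.
exact/containing_sub/subsetUr.
Qed.

(** * The switching *)

Lemma eq_set2 (V : finType) (a b c e : V) :
  ([set a; b] == [set c; e]) = (a == c) && (b == e) || (a == e) && (b == c).
Proof.
apply/eqP/orP => [E|[]/andP[/eqP-> /eqP->] //]; last by rewrite setUC.
have [ac|ac] := eqVneq a c; first by left; move: E; rewrite ac => /edge_inj->; rewrite !eqxx.
have [ae|ae] := eqVneq a e.
  by right; move: E; rewrite ae [RHS]setUC => /edge_inj->; rewrite !eqxx.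
have : a \in [set c; e] by rewrite -E !inE eqxx.
by rewrite !inE (negPf ac) (negPf ae).
Qed.

(** Switching along the 4-cycle u v z w: it trades the edge uv for uw. *)
Definition flip (V : finType) (u v w z : V) (G : {set {set V}}) :=
  [set u; w] |: ([set v; z] |: (G :\ [set u; v] :\ [set w; z])).

Lemma in_flip (V : finType) (u v w z : V) (G : {set {set V}}) (e : {set V}) :
  (e \in flip u v w z G) = [|| e == [set u; w], e == [set v; z] |
    [&& e != [set w; z], e != [set u; v] & e \in G]].
Proof. by rewrite !inE. Qed.

Lemma flipK (V : finType) (u v w z : V) (G : {set {set V}}) :
  [set u; v] \in G -> [set w; z] \in G ->
  [set u; w] \notin G -> [set v; z] \notin G ->
  flip u w v z (flip u v w z G) = G.
Proof.
move=> uvG wzG uwG vzG; apply/setP => e; rewrite !in_flip.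
have [->|_] := eqVneq e [set u; v]; first by rewrite uvG.
have [->|_] := eqVneq e [set w; z]; first by rewrite wzG.
have [->|_] := eqVneq e [set u; w]; first by rewrite (negPf uwG) /= andbF.
have [->|_] := eqVneq e [set v; z]; first by rewrite (negPf vzG).
by [].
Qed.

(** Every vertex lies in the two removed edges uv, wz as often as in the two
    inserted edges uw, vz. *)
Lemma flip_regular N d (u v w z : 'I_N) (G : {set {set 'I_N}}) :
  u != v -> u != w -> v != w -> z != v -> G \in regular_graphs N d ->
  [set u; v] \in G -> [set w; z] \in G ->
  [set u; w] \notin G -> [set v; z] \notin G ->
  flip u v w z G \in regular_graphs N d.
Proof.
move=> uv uw vw zv; rewrite !inE => /andP[sG /forallP rG] uvG wzG uwG vzG.
have wz := loop_notin sG wzG.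
have zu : z != u by apply: contraNneq uwG => <-; rewrite setUC.
apply/andP; split.
  apply/forallP => e; apply/implyP; rewrite in_flip.
  case/or3P => [/eqP->|/eqP->|/and3P[_ _ eG]].
  - by rewrite cards2 uw.
  - by rewrite cards2 (eq_sym v) zv.
  - exact: (implyP (forallP sG e)).
apply/forallP => x; rewrite -(eqP (rG x)) !degree_sum /flip.
have uwvz : [set u; w] != [set v; z].
  by rewrite eq_set2 (negPf uv) (eq_sym u z) (negPf zu).
have wzuv : [set w; z] != [set u; v].
  by rewrite eq_set2 (eq_sym w) (negPf uw) (eq_sym w) (negPf vw).
rewrite big_setU1 /=; last by rewrite !inE (negPf uwvz) (negPf uwG) !andbF.
rewrite big_setU1 /=; last by rewrite !inE (negPf vzG) !andbF.
rewrite [X in _ == X](big_setD1 _ uvG) /=.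
rewrite [X in _ == (_ + X)%N](big_setD1 [set w; z]) /=; last by rewrite !inE wzuv.
rewrite !addnA eqn_add2r !inE.
have [->|xu] := eqVneq x u.
  by rewrite (negPf uv) (negPf uw) (eq_sym u z) (negPf zu).
have [->|xv] := eqVneq x v.
  by rewrite (negPf vw) (eq_sym v z) (negPf zv).
have [->|xw] := eqVneq x w; first by rewrite (negPf wz).
by [].
Qed.

Definition private (V : finType) (G : {set {set V}}) (a b : V) :=
  [set z | [&& z != b, [set a; z] \in G & [set b; z] \notin G]].

Definition common (V : finType) (G : {set {set V}}) (a b : V) :=
  [set z | ([set a; z] \in G) && ([set b; z] \in G)].

(** The neighbours of a are the private ones, the common ones, and possibly b. *)
Lemma card_private N d (G : {set {set 'I_N}}) (a b : 'I_N) :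
  G \in regular_graphs N d ->
  (#|private G a b| + #|common G a b| + ([set a; b] \in G) = d)%N.
Proof.
rewrite inE => /andP[sG /forallP/(_ a)/eqP <-]; rewrite degreeE //.
have cardE (A : {set 'I_N}) : #|A| = (\sum_x (x \in A))%N.
  by rewrite -sum1_card big_mkcond.
rewrite !cardE; have -> : ([set a; b] \in G : nat) =
  (\sum_x ((x == b) && ([set a; x] \in G)))%N.
  rewrite (bigD1 b) //= eqxx big1 ?addn0 // => x /negPf-> //.
rewrite -!big_split /=; apply: eq_bigr => x _; rewrite !inE.
have [->|_] /= := eqVneq x b; last by case: (_ \in G) => //=; case: (_ \in G).
have /negPf-> : [set b; b] \notin G.
  by apply/negP => /(loop_notin sG); rewrite eqxx.
by rewrite andbF.
Qed.

Lemma card_privateC N d (G : {set {set 'I_N}}) (a b : 'I_N) :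
  G \in regular_graphs N d -> #|private G a b| = #|private G b a|.
Proof.
move=> rG; have := card_private a b rG; have := card_private b a rG.
have -> : common G b a = common G a b by apply/setP => x; rewrite !inE andbC.
rewrite [[set b; a]]setUC => <- /eqP.
by rewrite !eqn_add2r => /eqP.
Qed.

(** The number of private neighbours is a function of the degree, the codegree
    and the adjacency of v and w, and the switching affects none of these.  This
    is what allows the two sides of the double counting to be weighted alike. *)
Lemma card_private_flip N d (u v w z : 'I_N) (G : {set {set 'I_N}}) :
  u != v -> u != w -> v != w -> z != v -> G \in regular_graphs N d ->
  [set u; v] \in G -> [set w; z] \in G ->
  [set u; w] \notin G -> [set v; z] \notin G ->
  #|private (flip u v w z G) v w| = #|private G v w|.
Proof.
move=> uv uw vw zv rG uvG wzG uwG vzG.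
have := card_private v w (flip_regular uv uw vw zv rG uvG wzG uwG vzG).
rewrite -(card_private v w rG) in_flip.
have sG : simple_graph G by move: rG; rewrite inE => /andP[].
have wz := loop_notin sG wzG.
have zu : z != u by apply: contraNneq uwG => <-; rewrite setUC.
rewrite !eq_set2 (negPf vw) !eqxx (negPf wz) (eq_sym v u) (negPf uv) (eq_sym v z).
rewrite (negPf zv) (eq_sym w u) (negPf uw) /=.
suff -> : common (flip u v w z G) v w = common G v w.
  by move=> /eqP; rewrite !eqn_add2r => /eqP.
apply/setP => x; rewrite !inE !eq_set2 !eqxx (eq_sym v u) (negPf uv).
rewrite (negPf vw) (eq_sym w u) (negPf uw) (eq_sym v z) (negPf zv) (negPf wz).
rewrite (eq_sym w v) (negPf vw) /= ?andbT ?andbF ?orbF.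
have [->|xu] := eqVneq x u.
  by rewrite [[set w; u]]setUC (negPf uwG) (eq_sym u z) (negPf zu) !andbF.
have [->|xz] := eqVneq x z; first by rewrite (negPf vzG).
by [].
Qed.

(** * Double counting of switchings *)

Definition nbrs (V : finType) (G : {set {set V}}) (v : V) :=
  [set x | [set v; x] \in G].

Lemma card_nbrs (V : finType) (G : {set {set V}}) (v : V) :
  (#|nbrs G v| <= #|G|)%N.
Proof.
rewrite -(card_imset _ (@edge_inj V v)); apply: subset_leq_card.
by apply/subsetP => _ /imsetP[x + ->]; rewrite inE.
Qed.

Definition trading (N d : nat) (T : {set {set 'I_N}}) (e f : {set 'I_N}) :=
  [set G in containing d (e |: T) | f \notin G].

(** The hypotheses on T say that neither removed edge is required to stay. *)
Lemma trading_flip N d (T : {set {set 'I_N}}) (u v w z : 'I_N) (G : {set {set 'I_N}}) :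
  u != v -> u != w -> v != w ->
  [set u; v] \notin T -> [set w; z] \notin T ->
  G \in trading d T [set u; v] [set u; w] -> z \in private G w v ->
  [/\ flip u v w z G \in trading d T [set u; w] [set u; v],
      z \in private (flip u v w z G) v w,
      #|private (flip u v w z G) v w| = #|private G v w| &
      flip u w v z (flip u v w z G) = G].
Proof.
move=> uv uw vw uvT wzT; rewrite inE containingU1 => /andP[].
rewrite inE => /andP[]; rewrite inE => /andP[rG TG] uvG uwG.
rewrite inE => /and3P[zv wzG vzG].
have sG : simple_graph G by move: rG; rewrite inE => /andP[].
have wz := loop_notin sG wzG.
have zu : z != u by apply: contraNneq uwG => <-; rewrite setUC.
split; last by rewrite flipK.
- rewrite inE containingU1 inE inE flip_regular //= !in_flip !eq_set2 !eqxx.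
  rewrite (negPf vw) (negPf uw) (eq_sym v u) (negPf uv) (eq_sym u z) (negPf zu).
  rewrite ?andbF ?andbT /= ?andbT; apply/subsetP => e eT.
  rewrite in_flip (subsetP TG) // andbT; apply/or3P/Or33/andP.
  by split; [apply: contraNneq wzT | apply: contraNneq uvT] => <-.
- rewrite inE !in_flip !eq_set2 !eqxx (eq_sym z w) wz /= orbT /=.
  by rewrite (eq_sym w v) (negPf vw) (eq_sym w u) (negPf uw) (negPf zu) (negPf wz).
- exact: (card_private_flip uv uw vw zv rG uvG wzG uwG vzG).
Qed.

(** Double counting of the pairs of a graph and an admissible z, weighted by f of
    the invariant number of private neighbours.  From uv to uw, every z private
    to w may be used; in the reverse direction vz is removed, so that the z with
    vz in T are excluded. *)
Lemma switch_sum (R : realFieldType) N d (T : {set {set 'I_N}}) (u v w : 'I_N)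
    (f : nat -> R) :
  u != v -> u != w -> v != w -> [set u; v] \notin T -> w \notin cover T ->
  \sum_(G in trading d T [set u; v] [set u; w])
     f #|private G v w| * #|private G w v|%:R =
  \sum_(G in trading d T [set u; w] [set u; v])
     f #|private G v w| * #|private G v w :\: nbrs T v|%:R.
Proof.
move=> uv uw vw uvT wT.
have wedge x : [set w; x] \notin T.
  apply: contra wT => wxT; apply/bigcupP; exists [set w; x] => //.
  by rewrite !inE eqxx.
have uwT : [set u; w] \notin T by rewrite setUC.
have cardsum (c : R) (A : {set 'I_N}) : c * #|A|%:R = \sum_(z in A) c.
  by rewrite sumr_const mulr_natr.
under eq_bigr do rewrite cardsum.
under [RHS]eq_bigr do rewrite cardsum.
rewrite (exchange_big_dep xpredT) //= [RHS](exchange_big_dep xpredT) //=.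
apply: eq_bigr => z _.
rewrite (reindex_onto (flip u w v z) (flip u v w z)) /=; last first.
  by move=> G /andP[GA zG]; case: (trading_flip uv uw vw uvT (wedge z) GA zG).
have wv : w != v by rewrite eq_sym.
apply: eq_big => [G|G /andP[/andP[GA zG] /eqP E]]; last first.
  by case: (trading_flip uv uw vw uvT (wedge z) GA zG); rewrite E => _ _ ->.
apply/andP/andP => [[/andP[GA zG] /eqP E]|[GB]].
  have [] := trading_flip uv uw vw uvT (wedge z) GA zG; rewrite E => GB zGB _ _.
  split=> //; rewrite inE zGB andbT inE; apply: contraTN GA => vzT.
  rewrite inE containingU1 !inE !negb_and; apply/orP; left.
  apply/orP; left; apply/orP; right; apply/subsetPn; exists [set v; z] => //.
  have vuz : [set v; z] != [set u; v].
    apply: contraNneq uvT => <- //.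
  rewrite in_flip eqxx (negPf vuz) /= orbF.
  by apply: contraNneq (wedge z) => <-.
rewrite inE => /andP[]; rewrite inE => vzT zG.
have [GA zGA _ ->] := trading_flip uw uv wv uwT vzT GB zG.
by rewrite GA zGA eqxx.
Qed.

(** Graphs that contain both uv and uw cancel.  For the others, [switch_sum] is
    used with the weight 1/m, where m is the number of private neighbours. *)
Lemma card_containing_diff (R : realFieldType) N d (T : {set {set 'I_N}})
    (u v w : 'I_N) :
  u != v -> u != w -> v != w -> [set u; v] \notin T -> w \notin cover T ->
  #|containing d ([set u; w] |: T)|%:R - #|containing d ([set u; v] |: T)|%:R =
  \sum_(G in trading d T [set u; w] [set u; v])
     (1 - #|private G v w :\: nbrs T v|%:R / #|private G v w|%:R) :> R.
Proof.
move=> uv uw vw uvT wT.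
have split_card e f : #|containing d (e |: T)| =
    (#|trading d T e f| + #|containing d (f |: (e |: T))|)%N.
  rewrite addnC -(cardsID [set G : {set {set 'I_N}} | f \in G]); congr addn.
    by apply: eq_card => G; rewrite containingU1 !inE.
  by apply: eq_card => G; rewrite !inE andbC.
rewrite (split_card _ [set u; v]) (split_card [set u; v] [set u; w]) setUCA !natrD.
rewrite opprD addrACA subrr addr0 sumrB sumr_const; congr (_ - _).
rewrite -sum1_card natr_sum.
have sw := switch_sum d (fun m => m%:R^-1 : R) uv uw vw uvT wT.
under [RHS]eq_bigr do rewrite mulrC.
rewrite -sw; apply: eq_bigr => G; rewrite inE containingU1 => /andP[].
rewrite inE => /andP[]; rewrite inE => /andP[rG _] uvG uwG.
rewrite (card_privateC v w rG) mulVf // pnatr_eq0 -(card_privateC v w rG).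
rewrite -lt0n; apply/card_gt0P; exists u; rewrite inE uw setUC uvG setUC.
exact: uwG.
Qed.

(** Closing an edge inside T is never more likely than attaching a pendant one. *)
Lemma switch_le N d (T : {set {set 'I_N}}) (u v w : 'I_N) :
  u != v -> u != w -> v != w -> [set u; v] \notin T -> w \notin cover T ->
  (#|containing d ([set u; v] |: T)| <= #|containing d ([set u; w] |: T)|)%N.
Proof.
move=> uv uw vw uvT wT.
rewrite -(ler_nat rat) -subr_ge0 card_containing_diff //.
apply: sumr_ge0 => G _; rewrite subr_ge0.
have := subset_leq_card (subsetDl (private G v w) (nbrs T v)).
case: (posnP #|private G v w|) => [->|m0 le]; first by rewrite invr0 mulr0.
by rewrite ler_pdivrMr ?ltr0n // mul1r ler_nat.
Qed.

(** Each summand of [card_containing_diff] is at most #|T| / M if m >= M, since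
    at most #|T| vertices z have vz in T, and at most 1 otherwise. *)
Lemma switch_ge (R : realFieldType) N d (T : {set {set 'I_N}}) (u v w : 'I_N) (M : R) :
  u != v -> u != w -> v != w -> [set u; v] \notin T -> w \notin cover T -> 0 < M ->
  (1 - #|T|%:R / M) * #|containing d ([set u; w] |: T)|%:R
    - #|[set G in containing d ([set u; w] |: T) | #|private G v w|%:R < M]|%:R
  <= #|containing d ([set u; v] |: T)|%:R.
Proof.
move=> uv uw vw uvT wT M0; rewrite mulrBl mul1r -addrA -opprD lerBlDr -lerBlDl.
rewrite card_containing_diff // -[X in _ * X%:R + _]sum1_card natr_sum mulr_sumr.
rewrite -[X in _ + X%:R]sum1_card natr_sum.
rewrite [X in _ <= _ + X](eq_bigl (fun G => (G \in containing d ([set u; w] |: T))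
   && (#|private G v w|%:R < M))); last by move=> G; rewrite [LHS]inE.
rewrite [X in _ <= _ + X]big_mkcondr -big_split /= big_mkcond [leRHS]big_mkcond /=.
apply: ler_sum => G _; rewrite [G \in trading _ _ _ _]inE.
case: (G \in containing d _) => //=.
have MT : 0 <= #|T|%:R / M :> R by rewrite divr_ge0 // ltW.
case: ifP => _; last by rewrite mulr1 addr_ge0 //; case: ifP.
rewrite mulr1; case: ltP => [_|mM].
  rewrite lerBlDr -addrA addrC -addrA lerDl addr_ge0 // divr_ge0 //.
have m0 : 0 < #|private G v w|%:R :> R by apply: lt_le_trans mM.
(* The private neighbours lost are neighbours of v in T. *)
have le : #|private G v w|%:R - #|private G v w :\: nbrs T v|%:R <= #|T|%:R :> R.
  rewrite -(cardsID (nbrs T v) (private G v w)) natrD addrK ler_nat.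
  exact: leq_trans (subset_leq_card (subsetIr _ _)) (card_nbrs _ _).
rewrite addr0 -[X in X - _](divff (lt0r_neq0 m0)) -mulrBl ler_pdivrMr //.
rewrite mulrAC ler_pdivlMr //; apply: le_trans (_ : #|T|%:R * M <= _).
  by rewrite ler_wpM2r // ltW.
by rewrite ler_wpM2l.
Qed.

(** * Upper bounds for supersets and the codegree tail *)

(** A pendant edge is handled by [pendant_upper]; any other edge is at most as
    likely as a pendant one, by [switch_le]. *)
Lemma edge_upper N d (T : {set {set 'I_N}}) (u v : 'I_N) (K : nat) :
  u != v -> [set u; v] \notin T -> (#|u |: (v |: cover T)| <= K)%N ->
  ((N - K) * #|containing d ([set u; v] |: T)| <= d * #|containing d T|)%N.
Proof.
move=> uv uvT FK; have [/eqP->//|NK] := boolP (N - K == 0)%N.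
have FuK : (#|u |: cover T| <= K)%N.
  apply: leq_trans FK; apply/subset_leq_card/setUS/subsetUr.
have [w wF] : exists w, w \notin u |: (v |: cover T).
  have : (0 < #|~: (u |: (v |: cover T))|)%N by rewrite cardsCs setCK card_ord; lia.
  by case/card_gt0P => w; rewrite inE => wF; exists w.
move: wF; rewrite !inE !negb_or => /and3P[wu wv wT].
(* The vertex w is fresh, so uw is pendant and [switch_le] covers both cases. *)
apply: leq_trans (_ : _ <= (N - #|u |: cover T|) * #|containing d ([set u; w] |: T)|)%N _.
  apply: leq_mul; first exact: leq_sub2l.
  by apply: switch_le => //; rewrite eq_sym.
by apply: pendant_upper; rewrite !inE negb_or wu.
Qed.

(** Iterates [edge_upper] over the edges of S; L bounds the number of vertices at
    every stage. *)
Lemma superset_upper N d (T S : {set {set 'I_N}}) (L : nat) :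
  simple_graph S -> [disjoint S & T] -> (#|cover (S :|: T)| <= L)%N ->
  ((N - L) ^ #|S| * #|containing d (S :|: T)| <= d ^ #|S| * #|containing d T|)%N.
Proof.
move=> sS; have [m mS] := ubnP #|S|; elim: m => // m IH in S sS mS *.
have [->|[e eS]] := set_0Vmem S; first by rewrite set0U cards0 !mul1n.
move=> dST cL; set S' := S :\ e.
have SE : S = e |: S' by rewrite setD1K.
have cS : #|S| = #|S'|.+1 by rewrite (cardsD1 e) eS.
have sS' : simple_graph S'.
  apply/forallP => f; apply/implyP => /setD1P[_].
  exact: (implyP (forallP sS f)).
have dS'T : [disjoint S' & T] by apply: disjointWl dST; apply: subsetDl.
have sub : S' :|: T \subset S :|: T by apply/setSU/subsetDl.
have cL' : (#|cover (S' :|: T)| <= L)%N.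
  apply: leq_trans cL; apply/subset_leq_card/bigcupsP => f fS.
  by apply: (bigcup_sup f); apply: (subsetP sub).
have IHS := IH S' sS' _ dS'T cL'.
have /cards2P[u [v [uv eE]]] := implyP (forallP sS e) eS.
have eT : [set u; v] \notin S' :|: T.
  by rewrite -eE !inE eqxx /= (disjointFr dST eS).
have EU : S :|: T = [set u; v] |: (S' :|: T) by rewrite setUA -eE -SE.
have FK : (#|u |: (v |: cover (S' :|: T))| <= L)%N.
  apply: leq_trans cL; apply: subset_leq_card; rewrite setUA.
  rewrite EU; apply/subUsetP; split.
    by apply: (bigcup_sup [set u; v]); rewrite !inE eqxx.
  by apply/bigcupsP => f fS; apply: (bigcup_sup f); rewrite // in_setU1 fS orbT.
have := edge_upper d uv eT FK; rewrite -EU cS !expnS => le.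
rewrite mulnAC mulnC; apply: leq_trans (_ : (N - L) ^ #|S'| * (d * #|containing d (S' :|: T)|) <= _)%N.
  by rewrite leq_mul2l le orbT.
rewrite mulnCA -mulnA leq_mul2l IHS ?orbT //.
by move: mS; rewrite cS.
Qed.

Definition cherries (V : finType) (v w : V) (Z : {set V}) :=
  [set [set v; z] | z in Z] :|: [set [set w; z] | z in Z].

(** The case of [superset_upper] that bounds the codegree moments: #|Z| paths of
    length two from v to w through fresh middle vertices. *)
Lemma cherries_upper N d (T : {set {set 'I_N}}) (v w : 'I_N) (Z : {set 'I_N}) (L : nat) :
  v != w -> [disjoint Z & v |: (w |: cover T)] ->
  (#|v |: (w |: cover T)| + #|Z| <= L)%N ->
  ((N - L) ^ (2 * #|Z|) * #|containing d (cherries v w Z :|: T)|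
    <= d ^ (2 * #|Z|) * #|containing d T|)%N.
Proof.
move=> vw dZ cL.
have zF z : z \in Z -> [/\ z != v, z != w & z \notin cover T].
  by move=> /(disjointFr dZ); rewrite !inE => /norP[-> /norP[-> ->]].
have eT a z : z \in Z -> [set a; z] \notin T.
  move=> zZ; have [_ _] := zF z zZ; apply: contra => azT.
  by apply/bigcupP; exists [set a; z]; rewrite ?inE ?eqxx ?orbT.
have <- : #|cherries v w Z| = (2 * #|Z|)%N.
  rewrite cardsU !(card_imset _ (@edge_inj _ _)) addnn -mul2n.
  rewrite -[RHS]subn0; congr subn; apply/eqP; rewrite cards_eq0 -subset0.
  apply/subsetP => e /setIP[/imsetP[z zZ ->] /imsetP[y yZ /eqP]].
  have [_ zw _] := zF z zZ.
  by rewrite eq_set2 (negPf vw) (negPf zw) andbF.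
apply: superset_upper.
- apply/forallP => e; apply/implyP => /setUP[] /imsetP[z /zF[zv zw _] ->].
    by rewrite cards2 eq_sym (eq_sym v) zv.
  by rewrite cards2 eq_sym (eq_sym w) zw.
- rewrite -setI_eq0 -subset0; apply/subsetP => e /setIP[/setUP[]].
    by case/imsetP => z zZ -> /(negP (eT _ _ zZ)).
  by case/imsetP => z zZ -> /(negP (eT _ _ zZ)).
- apply: leq_trans cL; apply: leq_trans (leq_card_setU _ _).
  apply/subset_leq_card/bigcupsP => e /setUP[/setUP[]|eT'].
  + by case/imsetP => z zZ ->; apply/subsetP => x /set2P[]->; rewrite !inE ?eqxx ?zZ ?orbT.
  + by case/imsetP => z zZ ->; apply/subsetP => x /set2P[]->; rewrite !inE ?eqxx ?zZ ?orbT.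
  + apply/subsetP => x xe; rewrite !inE.
    suff -> : x \in cover T by rewrite !orbT.
    by apply/bigcupP; exists e.
Qed.

Lemma cherries_sub (V : finType) (v w : V) (Z : {set V}) (G : {set {set V}}) :
  (cherries v w Z \subset G) = (Z \subset common G v w).
Proof.
apply/subsetP/subsetP => [h z zZ|h e /setUP[]/imsetP[z /h + ->]].
- by rewrite inE !h // inE; apply/orP; [right|left]; apply: imset_f.
- by rewrite inE => /andP[].
- by rewrite inE => /andP[].
Qed.

(** An r-set of common neighbours of v and w in a graph containing T is the same
    as a family of r cherries in it. *)
Lemma common_moment N d (T : {set {set 'I_N}}) (v w : 'I_N) (X : {set 'I_N}) (r : nat) :
  (\sum_(G in containing d T) 'C(#|common G v w :\: X|, r) =
   \sum_(Z : {set 'I_N} | (Z \subset ~: X) && (#|Z| == r))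
      #|containing d (cherries v w Z :|: T)|)%N.
Proof.
transitivity (\sum_(G in containing d T)
    \sum_(Z : {set 'I_N} | (Z \subset common G v w :\: X) && (#|Z| == r)) 1)%N.
  apply: eq_bigr => G _; rewrite sum1_card -cards_draws; apply: eq_card => Z.
  by rewrite [RHS]unfold_in /= inE.
rewrite (exchange_big_dep (fun Z : {set 'I_N} => (Z \subset ~: X) && (#|Z| == r))) /=; last first.
  by move=> G Z _ /andP[+ ->]; rewrite setDE subsetI => /andP[_ ->].
apply: eq_bigr => Z /andP[ZX Zr]; rewrite sum1_card; apply: eq_card => G.
rewrite unfold_in /= !inE Zr andbT setDE subsetI ZX andbT subUset -cherries_sub.
by rewrite -!andbA; congr (_ && (_ && _)); rewrite andbC.
Qed.

(** Markov's inequality for the r-th binomial moment of the codegree, using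
    (k - r)^r <= r! C(k, r) and r! C(N, r) <= N^r. *)
Lemma common_tail N d (T : {set {set 'I_N}}) (v w : 'I_N) (k r K : nat) :
  v != w -> (#|v |: (w |: cover T)| <= K)%N -> (r <= k)%N ->
  (#|[set G in containing d T | k <= #|common G v w :\: (v |: (w |: cover T))|]|
     * ((k - r) ^ r * (N - (K + r)) ^ (2 * r))
   <= N ^ r * d ^ (2 * r) * #|containing d T|)%N.
Proof.
move=> vw XK rk.
have ff : ((k - r) ^ r <= k ^_ r)%N.
  elim: r k rk => [|r IH] [|k] //= rk.
  rewrite subSS ffactnS /= expnS leq_mul //; last exact: IH.
  by apply: leq_trans (leq_subr _ _) _.
set X := v |: _ in XK *; set L := (K + r)%N.
set bad := [set G in _ | _].
have moment : (#|bad| * 'C(k, r) * (N - L) ^ (2 * r) <=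
               'C(N, r) * (d ^ (2 * r) * #|containing d T|))%N.
  apply: (@leq_trans ((\sum_(G in containing d T) 'C(#|common G v w :\: X|, r))
            * (N - L) ^ (2 * r))%N).
    rewrite leq_mul2r -sum_nat_const; apply/orP; right.
    rewrite big_mkcond [leqRHS]big_mkcond /=; apply: leq_sum => G _.
    rewrite /bad inE; case: (G \in containing d T) => //=.
    by case: ifP => // kG; apply: leq_bin2l.
  rewrite common_moment big_distrl /=.
  apply: (@leq_trans (\sum_(Z : {set 'I_N} | (Z \subset ~: X) && (#|Z| == r))
                    d ^ (2 * r) * #|containing d T|)%N).
    apply: leq_sum => Z /andP[ZX /eqP Zr]; rewrite mulnC -Zr.
    apply: cherries_upper => //; last by rewrite Zr leq_add2r.
    by rewrite disjoints_subset.
  rewrite sum_nat_const leq_mul2r; apply/orP; right.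
  rewrite -[X in 'C(X, _)](card_ord N) -cardsT -cards_draws.
  apply: subset_leq_card; apply/subsetP => Z; rewrite !inE subsetT.
  by case/andP.
have ff' : (N ^_ r <= N ^ r)%N.
  rewrite ffact_prod -[X in (_ <= _ ^ X)%N](card_ord r) -prod_nat_const.
  by apply: leq_prod => i _; apply: leq_subr.
apply: (@leq_trans (#|bad| * (k ^_ r * (N - L) ^ (2 * r)))%N).
  by rewrite leq_mul2l leq_mul2r ff !orbT.
rewrite -bin_ffact.
have -> : (#|bad| * ('C(k, r) * r`! * (N - L) ^ (2 * r)) =
  (#|bad| * 'C(k, r) * (N - L) ^ (2 * r)) * r`!)%N by ring.
apply: leq_trans (leq_mul moment (leqnn _)) _.
have -> : ('C(N, r) * (d ^ (2 * r) * #|containing d T|) * r`! =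
  ('C(N, r) * r`!) * d ^ (2 * r) * #|containing d T|)%N by ring.
by rewrite bin_ffact -!mulnA leq_mul2r ff' orbT.
Qed.

(** If fewer than d/8 neighbours of v are private, then v and w have at least
    3d/4 common neighbours outside T.  With r = d/16 in [common_tail], the base
    N d^2 / ((k - r) (N - K - r)^2) is at most 9/10, because 2 d <= N.  Bernoulli's
    inequality turns the exponential decay (9/10)^r into the bound 144/d. *)
Lemma private_tail N d (T : {set {set 'I_N}}) (v w : 'I_N) (K : nat) :
  v != w -> (#|v |: (w |: cover T)| <= K)%N ->
  (8 * K.+1 <= d)%N -> (2 * d <= N)%N ->
  (#|[set G in containing d T | 8 * #|private G v w| < d]| * d
    <= 144 * #|containing d T|)%N.
Proof.
move=> vw XK Kd dN; set c := #|containing d T|.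
have d0 : (0 < d)%N by lia.
have N0 : (0 < N)%N by lia.
set r := (d %/ 16)%N; set k := ((3 * d + 3) %/ 4)%N.
have rk : (r <= k)%N by rewrite /r /k; lia.
have := @common_tail N d T v w k r K vw XK rk.
set X := v |: _ in XK *; rewrite -/c; set x := #|_|; set y := #|_| => tail.
have yx : (y <= x)%N.
  apply: subset_leq_card; apply/subsetP => G.
  rewrite inE => /andP[GT pd]; rewrite inE GT /= /k.
  have /setIdP[rG _] := GT; have := card_private v w rG; move: pd.
  have := cardsID X (common G v w).
  have := subset_leq_card (subsetIr (common G v w) X).
  move: XK Kd; rewrite -/X.
  move: #|X| #|_ :&: X| #|_ :\: X| #|common G v w| #|private G v w|; clear.
  case: (_ \in G) => /=; lia.
(* 9 (11/16) (9/10)^2 > 5, and N d^2 <= d N^2 / 2. *)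
have key : (10 * (N * d ^ 2) <= 9 * ((k - r) * (N - (K + r)) ^ 2))%N.
  have a16 : (11 * d <= 16 * (k - r))%N by rewrite /k /r; lia.
  have b32 : (9 * N <= 10 * (N - (K + r)))%N by rewrite /r; lia.
  move: (k - r)%N (N - (K + r))%N a16 b32 => a b a16 b32.
  have b2 : ((9 * N) ^ 2 <= (10 * b) ^ 2)%N by rewrite leq_exp2r.
  have := leq_mul a16 b2; have := leq_mul dN (leqnn (d * N)).
  have -> : (11 * d * (9 * N) ^ 2 = 891 * (d * N ^ 2))%N by ring.
  have -> : (16 * a * (10 * b) ^ 2 = 1600 * (a * b ^ 2))%N by ring.
  have -> : (2 * d * (d * N) = 2 * (N * d ^ 2))%N by ring.
  have -> : (N * (d * N) = d * N ^ 2)%N by ring.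
  by move: (d * N ^ 2)%N (N * d ^ 2)%N (a * b ^ 2)%N; clear; lia.
have keyr : ((10 * (N * d ^ 2)) ^ r <= (9 * ((k - r) * (N - (K + r)) ^ 2)) ^ r)%N.
  by case: (posnP r) => [->//|r0]; rewrite leq_exp2r.
have P0 : (0 < (N * d ^ 2) ^ r)%N by rewrite expn_gt0 muln_gt0 expn_gt0 N0 d0.
have geo : (x * 10 ^ r <= 9 ^ r * c)%N.
  rewrite -(leq_pmul2r P0).
  have -> : (x * 10 ^ r * (N * d ^ 2) ^ r = x * (10 * (N * d ^ 2)) ^ r)%N.
    by rewrite [((10 * _) ^ _)%N]expnMn mulnA.
  apply: (@leq_trans (x * (9 * ((k - r) * (N - (K + r)) ^ 2)) ^ r)%N).
    by rewrite leq_mul2l keyr orbT.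
  rewrite expnMn [(((k - r) * _) ^ r)%N]expnMn [((N * _) ^ r)%N]expnMn -!expnM.
  have -> : (9 ^ r * c * (N ^ r * d ^ (2 * r)) = 9 ^ r * (N ^ r * d ^ (2 * r) * c))%N.
    by ring.
  by rewrite mulnCA leq_mul2l tail orbT.
(* Bernoulli's inequality (10/9)^r >= 1 + r/9, cleared of denominators. *)
have bern : (9 ^ r * (9 + r) <= 10 ^ r * 9)%N.
  elim: (r) => [|s IH]; first by rewrite !expn0.
  rewrite !expnS; move: IH; move: (9 ^ s)%N (10 ^ s)%N => A B {tail key keyr geo P0 yx}; nia.
have : (x * (9 + r) <= 9 * c)%N.
  have P9 : (0 < 9 ^ r)%N by rewrite expn_gt0.
  rewrite -(leq_pmul2l P9).
  move: bern geo P9; move: (9 ^ r)%N (10 ^ r)%N => A B AB BA _.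
  have := leq_mul (leqnn x) AB; clear -BA; nia.
have rd : (d <= 16 * (9 + r))%N by rewrite /r; clear; lia.
have := leq_mul yx rd; rewrite mulnCA.
by clearbody c; move: (y * d)%N (x * (9 + r))%N; clear; lia.
Qed.

(** * Adding one edge *)

(** The arithmetic of [edge_estimate], where a, b, c stand for c(T + uv),
    c(T + uw) and c(T), K bounds the number of vertices, and n = #|T|. *)
Lemma edge_arith (R : realFieldType) (N d K a b c n : R) :
  (N - K) * a <= d * c -> d * c <= N * b + K * c ->
  (d - 8 * n) * b - 144 * b <= d * a ->
  2 * d <= N -> 8 * K <= d -> 8 * n + 144 <= d ->
  0 <= K -> 0 <= a -> 0 <= b -> 0 <= c -> 0 <= n -> 0 < d ->
  `|N * a - d * c| <= (8 * n + 144 + 2 * K) * c.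
Proof.
move=> up low ge N2 K8 n8 K0 a0 b0 c0 n0 d0.
have q0 : 0 <= d - 8 * n - 144 by lra.
have lowN : (d - 8 * n - 144) * ((d - K) * c) <= (d - 8 * n - 144) * (N * b).
  by apply: ler_wpM2l => //; lra.
have geN : N * ((d - 8 * n) * b - 144 * b) <= N * (d * a).
  by apply: ler_wpM2l => //; lra.
have pos : 0 <= (8 * n + 144) * (K * c) by rewrite !mulr_ge0 //; lra.
rewrite ler_norml; apply/andP; split.
  rewrite -(ler_pM2l d0).
  have Kdc : 0 <= d * (K * c) by rewrite !mulr_ge0 // ltW.
  by lra.
have NK0 : 0 < N - K by lra.
rewrite -(ler_pM2l NK0).
have := ler_wpM2l (_ : 0 <= N) up; rewrite (_ : 0 <= N); last by lra.
move=> /(_ isT) upN.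
have h1 : 0 <= (N - 2 * K) * (K * c) by rewrite !mulr_ge0 //; lra.
have h2 : 0 <= (N - K) * ((8 * n + 144) * c) by rewrite !mulr_ge0 //; lra.
have h3 : 0 <= (N - 2 * d) * (K * c) by rewrite !mulr_ge0 //; lra.
have h4 : 0 <= d * (K * c) by rewrite !mulr_ge0 // ltW.
by lra.
Qed.

(** The fresh vertex w gives both bounds: the upper one is [edge_upper]; the lower
    one chains [pendant_lower] for uw with [switch_ge] for M = d/8, where the
    exceptional graphs are counted by [private_tail]. *)
Lemma edge_estimate (R : realFieldType) N d (T : {set {set 'I_N}}) (u v : 'I_N) (K : nat) :
  u != v -> [set u; v] \notin T -> (#|cover T| + 3 <= K)%N ->
  (8 * K.+1 <= d)%N -> (8 * #|T| + 144 <= d)%N -> (2 * d <= N)%N ->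
  `|N%:R * #|containing d ([set u; v] |: T)|%:R - d%:R * #|containing d T|%:R|
    <= (8 * #|T| + 144 + 2 * K)%N%:R * #|containing d T|%:R :> R.
Proof.
move=> uv uvT TK Kd Td dN.
have card3 x y z : (#|x |: (y |: (z |: cover T))| <= K)%N.
  apply: leq_trans TK; rewrite !cardsU1; do 3!case: (_ \notin _) => /=; lia.
have FK x y : (#|x |: (y |: cover T)| <= K)%N.
  apply: leq_trans (card3 x y u); apply: subset_leq_card.
  by do 2!apply: setUS; apply: subsetUr.
have F1 x : (#|x |: cover T| <= K)%N.
  by apply: leq_trans (FK x u); apply/subset_leq_card/setUS/subsetUr.
have [w wF] : exists w, w \notin u |: (v |: cover T).
  have : (0 < #|~: (u |: (v |: cover T))|)%N.
    by rewrite cardsCs setCK card_ord subn_gt0 (leq_ltn_trans (FK u v)) //; lia.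
  by case/card_gt0P => w; rewrite inE => wF; exists w.
move: wF; rewrite !inE !negb_or => /and3P[wu wv wT].
have uw : u != w by rewrite eq_sym.
have vw : v != w by rewrite eq_sym.
have up := edge_upper d uv uvT (FK u v).
have low : (d * #|containing d T| <=
   N * #|containing d ([set u; w] |: T)| + K * #|containing d T|)%N.
  have wuT : w \notin u |: cover T by rewrite !inE negb_or wu.
  by apply: leq_trans (pendant_lower d wuT) _; rewrite leq_add2l leq_mul2r F1 orbT.
have XK : (#|v |: (w |: cover ([set u; w] |: T))| <= K)%N.
  apply: leq_trans (card3 u v w); apply/subset_leq_card/subsetP => x.
  rewrite !inE /cover bigcup_setU big_set1 !inE.
  by do 3!case: (x == _) => //=; rewrite ?orbT.
have tail := private_tail vw XK Kd dN.
have d0 : 0 < d%:R :> R by rewrite ltr0n; clear -Kd; lia.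
have M0 : 0 < d%:R / 8 :> R by rewrite divr_gt0.
have := switch_ge d uv uw vw uvT wT M0.
have -> : [set G in containing d ([set u; w] |: T) | #|private G v w|%:R < d%:R / 8 :> R]
  = [set G in containing d ([set u; w] |: T) | (8 * #|private G v w| < d)%N].
  apply/setP => G; rewrite !inE; congr (_ && _).
  by rewrite ltr_pdivlMr // -natrM ltr_nat mulnC.
move: tail low up.
set bad := #|[set G in _ | _]|; set a := #|containing d ([set u; v] |: T)|.
set b := #|containing d ([set u; w] |: T)|; set c := #|containing d T|.
move=> tail low up ge.
have {}up : (N%:R - K%:R) * a%:R <= d%:R * c%:R :> R.
  by rewrite -natrB; [rewrite -!natrM ler_nat | clear -Kd dN; lia].
have {}low : d%:R * c%:R <= N%:R * b%:R + K%:R * c%:R :> R.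
  by rewrite -!natrM -natrD ler_nat.
have {}tail : bad%:R * d%:R <= 144 * b%:R :> R by rewrite -!natrM ler_nat.
have N2 : 2 * d%:R <= N%:R :> R by rewrite -natrM ler_nat.
have K8 : 8 * K%:R <= d%:R :> R by rewrite -natrM ler_nat; clear -Kd; lia.
have n8 : 8 * #|T|%:R + 144 <= d%:R :> R by rewrite -natrM -natrD ler_nat.
have {}ge : (d%:R - 8 * #|T|%:R) * b%:R - 144 * b%:R <= d%:R * a%:R :> R.
  apply: le_trans (_ : (d%:R - 8 * #|T|%:R) * b%:R - bad%:R * d%:R <= _).
    by rewrite lerD2l lerN2.
  have := ler_wpM2l (ltW d0) ge; congr (_ <= _); field.
  by rewrite lt0r_neq0.
have K0 : 0 <= K%:R :> R by [].
have a0 : 0 <= a%:R :> R by [].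
have b0 : 0 <= b%:R :> R by [].
have c0 : 0 <= c%:R :> R by [].
have n0 : 0 <= #|T|%:R :> R by [].
have -> : (8 * #|T| + 144 + 2 * K)%N%:R = 8 * #|T|%:R + 144 + 2 * K%:R :> R.
  by rewrite -!natrM -!natrD.
exact: (edge_arith up low ge).
Qed.

(** * Graphs of density at most one half *)

Lemma card_cover_simple (V : finType) (T : {set {set V}}) :
  simple_graph T -> (#|cover T| <= 2 * #|T|)%N.
Proof.
move=> sT; apply: leq_trans (leq_card_cover T) _.
rewrite mulnC -sum_nat_const; apply: leq_sum => e eT.
by rewrite (eqP (implyP (forallP sT e) eT)).
Qed.

(** Each of the n steps of [edge_estimate] costs a factor 1 + O(1/d). *)
Lemma sparse_estimate (R : realFieldType) (n : nat) :
  exists C D : nat, forall (N d : nat) (T : {set {set 'I_N}}),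
    simple_graph T -> #|T| = n -> (D <= d)%N -> (2 * d <= N)%N ->
    `|N%:R ^+ n * #|containing d T|%:R - d%:R ^+ n * #|containing d (@set0 {set 'I_N})|%:R|
      * d%:R <= C%:R * (d%:R ^+ n * #|containing d (@set0 {set 'I_N})|%:R) :> R.
Proof.
elim: n => [|n [C [D IH]]].
  exists 0%N, 0%N => N d T _ /eqP; rewrite cards_eq0 => /eqP-> _ _.
  by rewrite subrr normr0 !mul0r.
set K := (2 * n + 3)%N; set C1 := (8 * n + 144 + 2 * K)%N.
exists (C1 * C.+1 + C)%N, (maxn D (8 * K.+1 + 8 * n + 144)).
move=> N d T sT cT; rewrite geq_max => /andP[Dd Cd] dN.
have [e eT] : exists e, e \in T by apply/card_gt0P; rewrite cT.
set T' := T :\ e.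
have TE : T = e |: T' by rewrite setD1K.
have cT' : #|T'| = n by move: cT; rewrite (cardsD1 e) eT => -[].
have sT' : simple_graph T'.
  apply/forallP => f; apply/implyP => /setD1P[_].
  exact: (implyP (forallP sT f)).
have /cards2P[u [v [uv eE]]] := implyP (forallP sT e) eT.
have uvT' : [set u; v] \notin T' by rewrite -eE !inE eqxx.
have KT : (#|cover T'| + 3 <= K)%N.
  by have := card_cover_simple sT'; rewrite cT' leq_add2r.
have := IH N d T' sT' cT' Dd dN.
have K1 : (8 * K.+1 <= d)%N by clear -Cd; lia.
have K2 : (8 * #|T'| + 144 <= d)%N by rewrite cT'; clear -Cd; lia.
have := edge_estimate R uv uvT' KT K1 K2 dN.
rewrite cT' -/C1 -eE -TE; set a := #|containing d T|%:R; set c := #|containing d T'|%:R.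
set c0 := #|containing d set0|%:R => E1 E2.
have d1 : 1 <= d%:R :> R by rewrite ler1n; clear -Cd; lia.
have d0 : 0 < d%:R :> R by apply: lt_le_trans d1.
have Nn : 0 <= N%:R ^+ n :> R by rewrite exprn_ge0.
have dc0 : 0 <= d%:R ^+ n * c0 by rewrite mulr_ge0 // exprn_ge0.
have C0 : 0 <= C%:R :> R by [].
have C10 : 0 <= C1%:R :> R by [].
have E3 : N%:R ^+ n * c <= (C.+1)%:R * (d%:R ^+ n * c0).
  rewrite -natr1 mulrDl mul1r -lerBlDr; apply: le_trans E2.
  by apply: le_trans (ler_norm _) _; rewrite ler_peMr.
rewrite !exprSr.
have -> : N%:R ^+ n * N%:R * a - d%:R ^+ n * d%:R * c0 =
  N%:R ^+ n * (N%:R * a - d%:R * c) + d%:R * (N%:R ^+ n * c - d%:R ^+ n * c0).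
  by ring.
have -> : (C1 * C.+1 + C)%N%:R * (d%:R ^+ n * d%:R * c0) =
  (C1%:R * ((C.+1)%:R * (d%:R ^+ n * c0)) + C%:R * (d%:R ^+ n * c0)) * d%:R.
  by rewrite natrD natrM; ring.
rewrite ler_pM2r //; apply: le_trans (ler_normD _ _) _.
rewrite !normrM (ger0_norm Nn) (ger0_norm (ltW d0)); apply: lerD.
  apply: le_trans (ler_wpM2l Nn E1) _.
  by rewrite mulrCA ler_wpM2l.
by rewrite mulrC.
Qed.

(** * Complements and inclusion-exclusion *)

Definition complement (V : finType) (G : {set {set V}}) :=
  [set e : {set V} | (#|e| == 2%N) && (e \notin G)].

Lemma complementK (V : finType) (G : {set {set V}}) :
  simple_graph G -> complement (complement G) = G.
Proof.
move=> sG; apply/setP => e; rewrite !inE negb_and negbK.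
have [e2|e2] /= := boolP (#|e| == 2%N); first by [].
by apply/esym; apply: contraNF e2 => /(implyP (forallP sG e)).
Qed.

Lemma complement_regular N d (G : {set {set 'I_N}}) :
  G \in regular_graphs N d -> complement G \in regular_graphs N (N - d.+1).
Proof.
rewrite !inE => /andP[sG /forallP rG].
have sC : simple_graph (complement G).
  by apply/forallP => e; apply/implyP; rewrite inE => /andP[].
rewrite sC; apply/forallP => v; rewrite degreeE // -(eqP (rG v)) degreeE //.
have -> : [set x | [set v; x] \in complement G] =
    ~: (v |: [set x | [set v; x] \in G]).
  apply/setP => x; rewrite !inE negb_or cards2 [x == v]eq_sym.
  by case: (v != x).
rewrite cardsCs setCK card_ord cardsU1 inE.
have -> : [set v; v] \notin G by apply/negP => /(loop_notin sG); rewrite eqxx.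
by rewrite add1n.
Qed.

(** Avoiding S is containing S in the complement. *)
Lemma containing_complement N d (S : {set {set 'I_N}}) : (d < N)%N ->
  simple_graph S ->
  #|[set G in regular_graphs N d | [disjoint S & G]]| = #|containing (N - d.+1) S|.
Proof.
move=> dN sS; have dd : (N - (N - d.+1).+1 = d)%N by lia.
have inj m : {in regular_graphs N m &, injective (@complement 'I_N)}.
  move=> G H; rewrite !inE => /andP[sG _] /andP[sH _] E.
  by rewrite -(complementK sG) E complementK.
have disjE (G : {set {set 'I_N}}) : [disjoint S & G] = (S \subset complement G).
  rewrite disjoints_subset; apply/subsetP/subsetP => h e eS.
    by rewrite inE (implyP (forallP sS e)) //=; have := h e eS; rewrite inE.
  by have := h e eS; rewrite !inE => /andP[].
rewrite -(@card_in_imset _ _ (@complement 'I_N)); last first.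
  by move=> G H /setIdP[GR _] /setIdP[HR _]; apply: inj GR HR.
apply: eq_card => H; apply/imsetP/idP => [[G /setIdP[GR GS] ->]|].
  by rewrite inE complement_regular // -disjE.
rewrite inE => /andP[HR SH]; have sH : simple_graph H by move: HR; rewrite inE => /andP[].
exists (complement H); last by rewrite complementK.
rewrite inE disjE complementK // SH andbT -[d in regular_graphs _ d]dd.
exact: complement_regular.
Qed.

Lemma prod1B_subsets (R : comPzRingType) (I : finType) (A : {set I}) (F : I -> R) :
  \prod_(i in A) (1 - F i) =
  \sum_(S : {set I} | S \subset A) (-1) ^+ #|S| * \prod_(i in S) F i.
Proof.
rewrite big_mkcond /=.
rewrite (eq_bigr (fun i => (if i \in A then - F i else 0) + 1)); last first.
  by move=> i _; case: ifP; rewrite ?add0r // addrC.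
rewrite bigA_distr [RHS]big_mkcond /=; apply: eq_bigr => S _.
case: ifPn => [/subsetP SA|/subsetPn[i iS iA]]; last first.
  by rewrite (bigD1 i) //= iS (negPf iA) mul0r.
rewrite -prodrN [RHS]big_mkcond /=; apply: eq_bigr => i _.
by case: ifP => // /SA ->.
Qed.

Lemma inclusion_exclusion (R : comPzRingType) N d (T : {set {set 'I_N}}) :
  (d < N)%N -> simple_graph T ->
  #|containing d T|%:R = \sum_(S : {set {set 'I_N}} | S \subset T)
    (-1) ^+ #|S| * #|containing (N - d.+1) S|%:R :> R.
Proof.
move=> dN sT.
have prod_ind (A : {set {set 'I_N}}) (P : pred {set 'I_N}) :
    \prod_(e in A) (P e)%:R = [forall e in A, P e]%:R :> R.
  have [/forall_inP h|] := boolP [forall e in A, P e].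
    by rewrite big1 // => e /h ->.
  by case/forall_inPn => e eA Pe; rewrite (bigD1 e) //= (negPf Pe) mul0r.
transitivity (\sum_(G in regular_graphs N d) \prod_(e in T) (1 - (e \notin G)%:R) : R).
  rewrite -sum1_card natr_sum big_mkcond [RHS]big_mkcond /=.
  apply: eq_bigr => G _; rewrite inE; case: (G \in _) => //=.
  rewrite (eq_bigr (fun e => (e \in G)%:R)) ?prod_ind; last first.
    by move=> e _; case: (e \in G); rewrite ?subr0 ?subrr.
  by case: subsetP => h; case: forall_inP.
under eq_bigr do rewrite prod1B_subsets.
rewrite exchange_big /=; apply: eq_bigr => S ST; rewrite -mulr_sumr; congr (_ * _).
have sS : simple_graph S.
  apply/forallP => f; apply/implyP => /(subsetP ST).
  exact: (implyP (forallP sT f)).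
rewrite -containing_complement // -sum1_card natr_sum big_mkcond [RHS]big_mkcond /=.
apply: eq_bigr => G _; rewrite [G \in [set _ in _ | _]]inE; case: (G \in _) => //=.
rewrite prod_ind disjoints_subset.
case: subsetP => h; case: forall_inP => // k; exfalso.
  by apply: k => e /h; rewrite inE.
by apply: h => e /k; rewrite inE.
Qed.

(** * All densities *)

Lemma sparse_estimate_le (R : realFieldType) (n : nat) :
  exists C D : nat, forall (N d : nat) (T : {set {set 'I_N}}),
    simple_graph T -> (#|T| <= n)%N -> (D <= d)%N -> (0 < d)%N -> (2 * d <= N)%N ->
    `|#|containing d T|%:R - (d%:R / N%:R) ^+ #|T| * #|containing d (@set0 {set 'I_N})|%:R|
      * d%:R <= C%:R * ((d%:R / N%:R) ^+ #|T| * #|containing d (@set0 {set 'I_N})|%:R) :> R.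
Proof.
have single m : exists C D : nat, forall (N d : nat) (T : {set {set 'I_N}}),
    simple_graph T -> #|T| = m -> (D <= d)%N -> (0 < d)%N -> (2 * d <= N)%N ->
    `|#|containing d T|%:R - (d%:R / N%:R) ^+ #|T| * #|containing d (@set0 {set 'I_N})|%:R|
      * d%:R <= C%:R * ((d%:R / N%:R) ^+ #|T| * #|containing d (@set0 {set 'I_N})|%:R) :> R.
  have [C [D est]] := sparse_estimate R m; exists C, D => N d T sT Tm Dd d0 dN.
  have {est} := est N d T sT Tm Dd dN; rewrite Tm.
  set c := #|_|%:R; set c0 := #|_|%:R => est.
  have N0 : 0 < N%:R ^+ m :> R by rewrite exprn_gt0 // ltr0n; lia.
  have dE : d%:R ^+ m = N%:R ^+ m * (d%:R / N%:R) ^+ m :> R.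
    by rewrite -exprMn mulrCA divff ?mulr1 // pnatr_eq0; lia.
  rewrite dE -mulrA -mulrBr normrM (ger0_norm (ltW N0)) in est.
  rewrite -(ler_pM2l N0) [leLHS]mulrA; apply: le_trans est _.
  by rewrite mulrCA.
elim: n => [|n [C [D IH]]].
  have [C [D h]] := single 0%N; exists C, D => N d T sT; rewrite leqn0 => /eqP.
  exact: h.
have [C' [D' h]] := single n.+1; exists (maxn C C'), (maxn D D').
move=> N d T sT Tn; rewrite geq_max => /andP[Dd Dd'] d0 dN.
set X := _ ^+ _ * _.
have X0 : 0 <= X by rewrite mulr_ge0 // exprn_ge0 // divr_ge0.
move: Tn; rewrite leq_eqVlt ltnS => /orP[/eqP Tn|Tn].
  apply: le_trans (h N d T sT Tn Dd' d0 dN) _.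
  by rewrite ler_wpM2r // ler_nat leq_maxr.
apply: le_trans (IH N d T sT Tn Dd d0 dN) _.
by rewrite ler_wpM2r // ler_nat leq_maxl.
Qed.

(** Only the case 2 d > N is left.  With q = (N - 1 - d) / N, the expansion of
    (1 - q)^n over the subsets of T matches [inclusion_exclusion] term by term,
    with error O(1/N) in each term.  Moreover 1 - q = p + 1/N, and since
    p >= 1/2 the absolute error O(1/N) is also a relative error O(1/d). *)
Lemma uniform_estimate (R : realFieldType) (n : nat) :
  exists C D : nat, forall (N d : nat) (T : {set {set 'I_N}}),
    simple_graph T -> #|T| = n -> (0 < d)%N -> (D <= d)%N -> (D + d < N)%N ->
    `|#|containing d T|%:R - (d%:R / N%:R) ^+ n * #|containing d (@set0 {set 'I_N})|%:R|
      * d%:R <= C%:R * ((d%:R / N%:R) ^+ n * #|containing d (@set0 {set 'I_N})|%:R) :> R.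
Proof.
have [C [D est]] := sparse_estimate_le R n.
exists (C + (2 ^ n * C + n) * 2 ^ n)%N, (maxn D 1) => N d T sT Tn d0.
rewrite geq_max => /andP[Dd _] DN.
set p := d%:R / N%:R; set c0 := #|containing d set0|%:R.
have p0 : 0 <= p by rewrite divr_ge0.
have pc0 : 0 <= p ^+ n * c0 by rewrite mulr_ge0 // exprn_ge0.
rewrite natrD mulrDl.
have [dN|Nd] := leqP (2 * d) N.
  have := est N d T sT _ Dd d0 dN; rewrite Tn -/p -/c0 => /(_ (leqnn _)) {}est.
  by apply: le_trans est _; rewrite lerDl mulr_ge0.
set d' := (N - d.+1)%N; set q : R := d'%:R / N%:R.
have dltN : (d < N)%N by lia.
have d'0 : (0 < d')%N by rewrite /d'; lia.
have d'N : (2 * d' <= N)%N by rewrite /d'; lia.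
have Dd' : (D <= d')%N by rewrite /d'; lia.
have N0 : 0 < N%:R :> R by rewrite ltr0n; lia.
have c0E : c0 = #|containing d' (@set0 {set 'I_N})|%:R.
  rewrite /c0 -containing_complement //; last first.
    by apply/forallP => e; rewrite inE.
  congr (_%:R); apply: eq_card => G; rewrite !inE sub0set.
  by rewrite -setI_eq0 set0I eqxx.
have c00 : 0 <= c0 by rewrite /c0.
have q1E : 1 - q = (d.+1)%:R / N%:R.
  rewrite /q /d' natrB // mulrBl divff ?lt0r_neq0 //; ring.
have q01 : 0 <= q <= 1.
  rewrite divr_ge0 //= ler_pdivrMr // mul1r ler_nat /d'; lia.
(* The factor q = d'/N, present unless S is empty, turns C/d' into C/N. *)
have stepS (S : {set {set 'I_N}}) : S \subset T ->
   `|#|containing d' S|%:R - q ^+ #|S| * c0| <= C%:R / N%:R * c0.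
  move=> ST; have sS : simple_graph S.
    apply/forallP => f; apply/implyP => /(subsetP ST).
    exact: (implyP (forallP sT f)).
  have [->|S0] := eqVneq S set0.
    by rewrite cards0 mul1r -c0E subrr normr0 mulr_ge0 // divr_ge0.
  have Sn : (#|S| <= n)%N by rewrite -Tn subset_leq_card.
  have := est N d' S sS Sn Dd' d'0 d'N; rewrite -/q -c0E => le.
  have d'R : 0 < d'%:R :> R by rewrite ltr0n.
  rewrite -(ler_pM2r d'R); apply: le_trans le _.
  have -> : C%:R / N%:R * c0 * d'%:R = C%:R * (q * c0) by rewrite /q; field; rewrite lt0r_neq0.
  rewrite ler_wpM2l // ler_wpM2r // -{2}[q]expr1.
  by case/andP: q01 => q0 q1; rewrite ler_wiXn2l // card_gt0.
have dense : `|#|containing d T|%:R - (1 - q) ^+ n * c0| <= (2 ^ n)%:R * (C%:R / N%:R * c0).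
  have -> : (1 - q) ^+ n = \prod_(e in T) (1 - q) by rewrite prodr_const Tn.
  rewrite prod1B_subsets mulr_suml (inclusion_exclusion _ dltN sT) -sumrB.
  apply: le_trans (ler_norm_sum _ _ _) _.
  apply: le_trans (_ : \sum_(S : {set {set 'I_N}} | S \subset T) C%:R / N%:R * c0 <= _).
    apply: ler_sum => S ST; rewrite prodr_const -[X in _ - X]mulrA -mulrBr normrM.
    by rewrite normrX normrN1 expr1n mul1r stepS.
  by rewrite sumr_const -Tn -card_powerset [leRHS]mulr_natl (@eq_card _ _ (mem (powerset T))) // => S; rewrite !inE.
have powdiff : `|(1 - q) ^+ n - p ^+ n| <= n%:R / N%:R.
  have pq : 1 - q - p = N%:R^-1 by rewrite q1E /p -natr1; ring.
  have q1p : 0 <= 1 - q <= 1 by case/andP: q01 => ? ?; rewrite subr_ge0 lerBlDr lerDl; apply/andP.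
  have p1 : p <= 1 by rewrite ler_pdivrMr // mul1r ler_nat ltnW.
  rewrite subrXX normrM pq ger0_norm ?invr_ge0 // mulrC ler_wpM2r ?invr_ge0 //.
  apply: le_trans (ler_norm_sum _ _ _) _.
  rewrite -[n in leRHS]card_ord -sumr_const; apply: ler_sum => i _.
  case/andP: q1p => q1p1 q1p2.
  by rewrite ger0_norm ?mulr_ge0 ?exprn_ge0 // mulr_ile1 ?exprn_ge0 ?exprn_ile1.
have tot : `|#|containing d T|%:R - p ^+ n * c0| <= (2 ^ n * C + n)%N%:R / N%:R * c0.
  have -> : #|containing d T|%:R - p ^+ n * c0 =
    (#|containing d T|%:R - (1 - q) ^+ n * c0) + ((1 - q) ^+ n - p ^+ n) * c0 by ring.
  apply: le_trans (ler_normD _ _) _; rewrite natrD natrM [in leRHS]mulrDl [in leRHS]mulrDl; apply: lerD.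
    by rewrite -!mulrA in dense *.
  by rewrite normrM (ger0_norm c00) ler_wpM2r.
have p2 : 1 <= (2 ^ n)%:R * p ^+ n.
  rewrite natrX -exprMn exprn_ege1 // mulrA ler_pdivlMr // mul1r -natrM ler_nat ltnW //.
apply: le_trans (_ : (2 ^ n * C + n)%N%:R * c0 <= _).
  apply: le_trans (ler_wpM2r _ tot) _ => //.
  rewrite (_ : _ / _ * _ * _ = (2 ^ n * C + n)%N%:R * (c0 * p)); last by rewrite /p; ring.
  by rewrite ler_wpM2l // ler_piMr // ler_pdivrMr // mul1r ler_nat ltnW.
rewrite -[leLHS]add0r; apply: lerD; first exact: mulr_ge0.
by rewrite natrM -[leRHS]mulrA ler_wpM2l // mulrA ler_peMl.
Qed.

(** * Existence of regular graphs *)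

Lemma card_ord_interval (N a b : nat) : (b <= N)%N ->
  (\sum_(i < N) (a <= i < b) = b - a)%N.
Proof.
move=> bN; rewrite -(big_mkord xpredT (fun i => a <= i < b : nat)%N).
rewrite -big_mkcond /= -[RHS]muln1 -sum_nat_const_nat.
rewrite (big_nat_widen _ _ _ _ _ bN) [RHS](big_nat_widenl _ 0) //=.
by apply: eq_bigl => i; rewrite andbC.
Qed.

Definition circulant (n : nat) (S : {set 'I_n.+1}) :=
  [set e : {set 'I_n.+1} | [exists v, exists s in S, e == [set v; v + s]]].

(** The neighbours of v are the translates v + s with s in S; symmetry of S makes
    the relation undirected. *)
Lemma circulant_regular (n : nat) (S : {set 'I_n.+1}) :
  0 \notin S -> {in S, forall s, - s \in S} ->
  circulant S \in regular_graphs n.+1 #|S|.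
Proof.
move=> S0 SN.
have sG : simple_graph (circulant S).
  apply/forallP => e; apply/implyP; rewrite inE => /existsP[v /exists_inP[s sS /eqP->]].
  rewrite cards2 -subr_eq0 opprD addNKr oppr_eq0.
  by have -> : s != 0 by apply: contraNneq S0 => <-.
rewrite inE sG; apply/forallP => v; rewrite degreeE //.
rewrite -[X in _ == X](card_imset _ (addrI v)); apply/eqP/eq_card => x; rewrite !inE.
apply/existsP/imsetP => [[y /exists_inP[s sS]]|[s sS ->]]; last first.
  by exists v; apply/exists_inP; exists s.
rewrite eq_set2 => /orP[/andP[/eqP-> /eqP->]|/andP[/eqP-> /eqP->]].
  by exists s.
by exists (- s); [exact: SN | rewrite addrK].
Qed.

(** A circulant graph whose connection set consists of the residues at distance
    at most d/2 from 0 and, if d is odd (so that N is even), of N/2. *)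
Lemma regular_graph_exists (N d : nat) : (0 < d < N)%N -> ~~ odd (N * d) ->
  (0 < #|regular_graphs N d|)%N.
Proof.
case: N => [|n]; first by rewrite ltn0 andbF.
set N := n.+1 => dN evenNd; apply/card_gt0P.
set k := d./2; set h := N./2.
pose S : {set 'I_n.+1} :=
  [set s : 'I_n.+1 | [|| 1 <= s < k.+1, N - k <= s < N | h <= s < h + odd d]%N].
have dE : d = (odd d + k + k)%N by rewrite -addnA addnn odd_double_half.
have NE : odd d -> N = (h + h)%N.
  by move=> od; rewrite addnn; move: evenNd; rewrite oddM od andbT => /even_halfK.
have kh : (k + odd d <= h)%N.
  rewrite /h; have := odd_double_half N; rewrite -/h -addnn.
  by case od : (odd d) dE NE => /= dE NE; [move/(_ isT): NE; lia | case: (odd N); lia].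
have hN : (h + odd d + k <= N)%N.
  by case od : (odd d) dE NE kh => /= dE NE; [move/(_ isT): NE; lia | rewrite /h; have := odd_double_half N; rewrite -/h -addnn; lia].
have cS : #|S| = d.
  transitivity (\sum_(i < N) ((1 <= i < k.+1) + (N - k <= i < N) + (h <= i < h + odd d)))%N.
    rewrite -sum1_card big_mkcond /=; apply: eq_bigr => i _; rewrite inE.
    have := ltn_ord i; rewrite -/N; move: (nat_of_ord i) => j jN.
    have [a1|] := boolP (1 <= j < k.+1)%N; have [a2|] := boolP (N - k <= j < N)%N;
    have [a3|] := boolP (h <= j < h + odd d)%N => //=; lia.
  rewrite !big_split /= !card_ord_interval; lia.
exists (circulant S).
suff : circulant S \in regular_graphs n.+1 #|S| by rewrite cS.
apply: circulant_regular.
  rewrite inE /=; apply/negP; move: (odd d : nat) kh hN dE => o; lia.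
move=> s; rewrite !inE /= => sS.
have sN := ltn_ord s.
have s0 : (0 < s)%N by move: sS dN; case od : (odd d) dE NE kh hN => /= dE NE; try (move/(_ isT): NE); lia.
rewrite modn_small; last by lia.
case/or3P: sS => sS; apply/or3P; [apply: Or32 | apply: Or31 | apply: Or33]; try lia.
Qed.

(** * Named vertices and the asymptotic statement *)

(** The vertex named k is the element k - 1 of 'I_n.+1. *)
Definition embed (V : finType) (name : V -> nat) (n : nat) (v : V) : 'I_n.+1 :=
  inord (name v).-1.

Definition embed_graph (V : finType) (name : V -> nat) (T : {set {set V}}) (n : nat)
    : {set {set 'I_n.+1}} :=
  [set [set embed name n x | x in (e : {set V})] | e in T].

Lemma embed_succ (V : finType) (name : V -> nat) (n : nat) (v : V) :
  (0 < name v <= n.+1)%N -> (embed name n v).+1 = name v.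
Proof. by case/andP => ? ?; rewrite inordK ?prednK. Qed.

Lemma embed_inj (V : finType) (name : V -> nat) (n : nat) :
  injective name -> (forall v, (0 < name v <= n.+1)%N) -> injective (embed name n).
Proof.
move=> name_inj name_range.
by move=> u v E; apply: name_inj; rewrite -!(embed_succ (name_range _)) E.
Qed.

Lemma embed_graph_simple (V : finType) (name : V -> nat) (T : {set {set V}}) (n : nat) :
  injective name -> (forall v, (0 < name v <= n.+1)%N) -> simple_graph T ->
  simple_graph (embed_graph name T n).
Proof.
move=> name_inj name_range T_simple.
apply/forallP => f; apply/implyP => /imsetP[e eT ->].
by rewrite card_imset ?(implyP (forallP T_simple e)) //; apply: embed_inj.
Qed.

Lemma card_embed_graph (V : finType) (name : V -> nat) (T : {set {set V}}) (n : nat) :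
  injective name -> (forall v, (0 < name v <= n.+1)%N) ->
  #|embed_graph name T n| = #|T|.
Proof. by move=> *; apply: card_imset; apply: imset_inj; apply: embed_inj. Qed.

(** As soon as every name is at most N, containing the named graph is containing
    a fixed edge set on [N]. *)
Lemma subgraph_embed (V : finType) (name : V -> nat) (T : {set {set V}}) (n : nat)
    (G : {set {set 'I_n.+1}}) :
  (forall v, (0 < name v <= n.+1)%N) -> simple_graph T ->
  subgraph name T G = (embed_graph name T n \subset G).
Proof.
move=> name_range T_simple.
apply/idP/subsetP => [sub _ /imsetP[e eT ->]|sub].
  have /cards2P[u [v [_ eE]]] := implyP (forallP T_simple e) eT.
  move: sub => /forallP/(_ u)/forallP/(_ v); rewrite -eE eT /=.
  case/existsP => i /existsP[j /and3P[/eqP iu /eqP jv ijG]].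
  rewrite eE imsetU1 imset_set1.
  have <- : i = embed name n u by apply/val_inj/succn_inj; rewrite /= embed_succ.
  by have <- : j = embed name n v by apply/val_inj/succn_inj; rewrite /= embed_succ.
apply/forallP => u; apply/forallP => v; apply/implyP => uvT.
apply/existsP; exists (embed name n u); apply/existsP; exists (embed name n v).
rewrite !embed_succ // !eqxx /=.
have -> : [set embed name n u; embed name n v] = [set embed name n x | x in [set u; v]].
  by rewrite imsetU1 imset_set1.
exact/sub/imset_f.
Qed.

Lemma prob_subgraph_containing (R : realFieldType) (V : finType) (name : V -> nat)
    (T : {set {set V}}) (n d : nat) :
  (forall v, (0 < name v <= n.+1)%N) -> simple_graph T ->
  #|[set G in regular_graphs n.+1 d | subgraph name T G]|%:R
    / #|regular_graphs n.+1 d|%:R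
  = #|containing d (embed_graph name T n)|%:R / #|containing d (@set0 {set 'I_n.+1})|%:R :> R.
Proof.
move=> range sT; congr (_%:R / _%:R); apply: eq_card => G.
  by rewrite !inE (subgraph_embed _ range sT).
by rewrite !inE sub0set andbT.
Qed.

From mathcomp Require Import all_classical all_reals all_analysis.
Import numFieldNormedType.Exports.
Local Open Scope classical_set_scope.

(** C/d is at most e / sqrt d once d >= (C/e)^2. *)
Lemma quotient_littleo (R : realType) (C : nat) (d : nat -> nat) (eps : nat -> R) :
  d N @[N --> \oo] --> \oo ->
  (\forall N \near \oo, `|eps N| * (d N)%:R <= C%:R) ->
  eps =o_\oo (fun N : nat => (Num.sqrt (d N)%:R)^-1 : R).
Proof.
move=> d_oo bound; apply/eqoP => e e0.
have [K CK] : exists K : nat, (C%:R / e) ^+ 2 <= K%:R.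
  exists (Num.truncn ((C%:R / e) ^+ 2)).+1; exact/ltW/truncnS_gt.
have /cvgnyPge/(_ (maxn K 1)) dK := d_oo.
near=> N.
have : (maxn K 1 <= d N)%N by near: N.
have : `|eps N| * (d N)%:R <= C%:R by near: N.
rewrite geq_max => le /andP[KN d1].
have s0 : 0 < Num.sqrt (d N)%:R :> R by rewrite sqrtr_gt0 ltr0n.
rewrite normfV (gtr0_norm s0) ler_pdivlMr //.
rewrite -(ler_pM2r s0) -mulrA -expr2 sqr_sqrtr // (le_trans le) //.
rewrite mulrC -ler_pdivrMr // -(@ler_pXn2r _ 2) ?nnegrE ?divr_ge0 ?(ltW e0) ?(ltW s0) //.
by rewrite sqr_sqrtr // (le_trans CK) // ler_nat.
Unshelve. all: by end_near. Qed.

(** [uniform_estimate] divided by p^n times the number of regular graphs, which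
    is not zero by [regular_graph_exists]. *)
Lemma prob_subgraph_estimate (R : realType) (V : finType) (name : V -> nat)
    (T : {set {set V}}) :
  injective name -> (forall v, (0 < name v)%N) -> simple_graph T ->
  exists C D : nat, forall N k : nat,
    (forall v, (name v <= N)%N) -> (0 < k)%N -> (D <= k)%N -> (D + k < N)%N ->
    ~~ odd (N * k) ->
    `|prob_subgraph R name T N k / (k%:R / N%:R) ^+ #|T| - 1| * k%:R <= C%:R.
Proof.
move=> name_inj name_pos T_simple.
have [C [D est]] := uniform_estimate R #|T|.
exists C, D => -[//|m] k le k0 Dk DN par.
have range v : (0 < name v <= m.+1)%N by rewrite name_pos le.
have {est} := est m.+1 k (embed_graph name T m) (embed_graph_simple name_inj range T_simple)
  (card_embed_graph T name_inj range) k0 Dk DN.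
rewrite /prob_subgraph prob_subgraph_containing // => est.
set c0 := #|containing k finset.set0|%:R in est *.
have c0_gt0 : 0 < c0.
  rewrite ltr0n; have := @regular_graph_exists m.+1 k _ par.
  rewrite (@eq_card _ _ (mem (containing k (@finset.set0 {set 'I_m.+1})))); last first.
    by move=> G; rewrite !inE finset.sub0set andbT.
  by apply; rewrite k0 (leq_ltn_trans _ DN) // leq_addl.
set q := (k%:R / m.+1%:R) ^+ #|T| in est *.
have q0 : 0 < q by rewrite exprn_gt0 // divr_gt0 // ltr0n.
have -> : #|containing k (embed_graph name T m)|%:R / c0 / q - 1 =
  (#|containing k (embed_graph name T m)|%:R - q * c0) / (q * c0).
  by field; rewrite !lt0r_neq0.
rewrite normrM normfV (ger0_norm (ltW (mulr_gt0 q0 c0_gt0))) mulrAC ler_pdivrMr ?mulr_gt0 //.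
Qed.

Theorem proposition1p4 (R : realType) (d : nat -> nat)
    (d_range : forall N : nat, (2 <= N)%N -> (1 <= d N <= N - 1)%N)
    (d_parity : forall N : nat, (2 <= N)%N -> ~~ odd (N * d N))
    (d_asymp : exists2 eta : R, 0 < eta &
      [/\ d N @[N --> \oo] --> \oo,
          (N - d N)%N @[N --> \oo] --> \oo &
          `|N%:R / 2 - (d N)%:R - eta * Num.sqrt (d N)%:R|
            @[N --> \oo] --> +oo])
    (V : finType) (name : V -> nat)
    (name_inj : injective name) (name_pos : forall v : V, (0 < name v)%N)
    (T : {set {set V}}) (T_simple : simple_graph T)
    (n : nat) (T_edges : #|T| = n) :
  exists2 eps : nat -> R,
    eps =o_\oo (fun N : nat => (Num.sqrt (d N)%:R)^-1 : R) &
    \forall N \near \oo,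
      prob_subgraph R name T N (d N) = ((d N)%:R / N%:R) ^+ n * (1 + eps N).
Proof.
have [eta _ [d_oo Nd_oo _]] := d_asymp.
have [C [D est]] := prob_subgraph_estimate R name_inj name_pos T_simple.
rewrite T_edges in est.
pose M := (\max_v name v)%N.
pose p N : R := (d N)%:R / N%:R.
exists (fun N => prob_subgraph R name T N (d N) / p N ^+ n - 1); last first.
  near=> N; have N2 : (2 <= N)%N by near: N; exact: nbhs_infty_ge.
  have /andP[d1 dN] := d_range N N2.
  rewrite addrC subrK mulrC divfK // expf_neq0 // mulf_neq0 ?invr_eq0 ?pnatr_eq0 //; lia.
apply: (@quotient_littleo _ C d) => //.
have /cvgnyPge/(_ D) dD := d_oo.
have /cvgnyPge/(_ D.+1) NdD := Nd_oo.
near=> N.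
have N2 : (2 <= N)%N by near: N; exact: nbhs_infty_ge.
have NM : (M <= N)%N by near: N; exact: nbhs_infty_ge.
have Dd : (D <= d N)%N by near: N.
have DN : (D.+1 <= N - d N)%N by near: N.
have /andP[d1 dN] := d_range N N2.
apply: est => //; last exact: d_parity.
  by move=> v; rewrite (leq_trans _ NM) // /M (leq_bigmax v).
by move: DN; rewrite ltn_subRL addnC.
Unshelve. all: by end_near. Qed.
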